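(* Consider $X=Y$. There is a key-agreement scheme that uses only one-way communication achieving the error-length pair $(0,\, H(X)-2)$.
   Context: Logarithms are base 2 and entropy is in bits. For $K\in\{0,1\}^*$ (finite bit sequences of any length), $|K|$ denotes its length, $K_n$ its $n$-th entry and $K^{n}=(K_1,\dots,K_n)$. A random $K\in\{0,1\}^*$ is a randomly-stopped bit sequence if $\mathbb{P}(K_n=k_n \mid |K|\ge n, K^{n-1}=k^{n-1})=1/2$ for all $n\ge 1$ and $k^n\in\{0,1\}^n$ with $\mathbb{P}(|K|\ge n, K^{n-1}=k^{n-1})>0$. $K$ is a conditionally randomly-stopped bit sequence given $W$ if $p_{K|W=w}$ is a randomly-stopped bit sequence distribution for every $w$ in the support of $W$. Key-agreement setting: $X,Y$ are correlated discrete random variables; Alice observes $X$, Bob observes $Y$; $G_A,G_B$ are local randomness with $(X,Y),G_A,G_B$ mutually independent. They alternate public messages $W_1$ (Alice, from $X,G_A$), $W_2$ (Bob, from $Y,G_B,W_1$), $W_3,\dots$ until stopping at time $N$; the scheme uses only one-way communication if $N=1$ always. Alice outputs $K_A$ (function of $X,G_A,W^N$), Bob outputs $K_B$ (function of $Y,G_B,W^N$). The scheme achieves the error-length pair $(\epsilon,\ell)$ if there exists a random $K\in\{0,1\}^*$ jointly distributed with all these variables such that: $K$ is a conditionally randomly-stopped bit sequence given $W^N$; $\mathbb{P}(K_A=K_B=K)\ge 1-\epsilon$; and $\mathbb{E}[|K|\cdot\mathbf{1}\{K_A=K_B=K\}]\ge \ell$. *)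

(* Defs.v *)
From HB Require Import structures.
From mathcomp Require Import all_boot all_order all_algebra.
From mathcomp Require Import all_classical all_reals.
From mathcomp Require Import ereal esum exp.
Set Implicit Arguments. Unset Strict Implicit. Unset Printing Implicit Defensive.
Import Order.TTheory GRing.Theory Num.Theory.
Local Open Scope classical_set_scope.
Local Open Scope ring_scope.

Section Defs.
Variable R : realType.

Definition is_pmf (T : countType) (p : T -> R) : Prop :=
  (forall t, 0 <= p t) /\ (\esum_(t in setT) (p t)%:E = 1%E).

(* probability of an event (p is a pmf, so the sum is finite) *)
Definition Pr (T : countType) (p : T -> R) (A : set T) : R :=
  fine (\esum_(t in A) (p t)%:E).

Definition log2 (x : R) : R := ln x / ln 2.

(* Shannon entropy in bits (convention 0 log 0 = 0; may be +oo) *)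
Definition entropy (T : countType) (p : T -> R) : \bar R :=
  \esum_(t in setT) (- (p t * log2 (p t)))%:E.

(* q (a pmf on finite bit sequences) is a randomly-stopped bit sequence
   distribution: for n >= 1, k of length n with
   P(|K| >= n, K^{n-1} = k^{n-1}) > 0, P(K_n = k_n | ...) = 1/2.
   K_n (1-indexed) is nth false K (n-1). *)
Definition randomly_stopped (q : seq bool -> R) : Prop :=
  forall (n : nat) (k : seq bool), (0 < n)%N -> size k = n ->
    let E := [set s : seq bool | (n <= size s)%N /\ take n.-1 s = take n.-1 k] in
    0 < Pr q E ->
    Pr q (E `&` [set s | nth false s n.-1 = nth false k n.-1]) / Pr q E = 1 / 2.

Definition cond_randomly_stopped (Om : countType) (p : Om -> R)
    (W_t : countType) (W : Om -> W_t) (K : Om -> seq bool) : Prop :=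
  forall w, 0 < Pr p [set om | W om = w] ->
    randomly_stopped (fun s => Pr p [set om | K om = s /\ W om = w]
                               / Pr p [set om | W om = w]).

(* There is a key-agreement scheme using only one-way communication
   (N = 1: one public message W1 = fW(X, G_A) from Alice) for the source with
   joint pmf pXY that achieves the error-length pair (eps, ell).
   The probability space Om, the local randomness alphabets, the message
   alphabet, and the extra variable K are all existentially chosen. *)
Definition one_way_achieves (X_t Y_t : countType) (pXY : X_t * Y_t -> R)
    (eps : R) (ell : \bar R) : Prop :=
  exists (Om : countType) (p : Om -> R) (GA_t GB_t W_t : countType)
         (XY : Om -> X_t * Y_t) (GA : Om -> GA_t) (GB : Om -> GB_t)
         (fW : X_t -> GA_t -> W_t)
         (fA : X_t -> GA_t -> W_t -> seq bool)
         (fB : Y_t -> GB_t -> W_t -> seq bool)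
         (K : Om -> seq bool),
    let W1 := fun om => fW (XY om).1 (GA om) in
    let KA := fun om => fA (XY om).1 (GA om) (W1 om) in
    let KB := fun om => fB (XY om).2 (GB om) (W1 om) in
    let good := fun om => (KA om == KB om) && (KB om == K om) in
    is_pmf p /\
        (forall xy, Pr p [set om | XY om = xy] = pXY xy) /\
        (forall xy a b,
           Pr p [set om | XY om = xy /\ GA om = a /\ GB om = b]
           = Pr p [set om | XY om = xy] * Pr p [set om | GA om = a]
             * Pr p [set om | GB om = b]) /\
        cond_randomly_stopped p W1 K /\
        1 - eps <= Pr p [set om | good om] /\
        (ell <= \esum_(om in setT)
                  ((size (K om))%:R * (if good om then 1 else 0) * p om)%:E)%E.

Definition diag_pmf (T : countType) (pX : T -> R) (xy : T * T) : R :=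
  if xy.1 == xy.2 then pX xy.1 else 0.

End Defs.

(* Main.v *)
Require Import Defs.
From mathcomp Require Import all_boot all_order all_algebra.
From mathcomp Require Import all_classical all_reals.
From mathcomp Require Import ereal normedtype sequences esum exp.
From mathcomp Require Import ring lra zify.
Import Order.TTheory GRing.Theory Num.Theory.
Local Open Scope ring_scope.
Local Open Scope classical_set_scope.
Set Implicit Arguments. Unset Strict Implicit.

(** Every pmf is p = w / 2 + f / 2 with f a pmf and w dyadic: round p up to
    powers of two, at least 1 in total; taken in decreasing order, the partial
    sums of the rounded masses hit 1 exactly, so that an initial segment carries
    a complete prefix code.  Iterating on f, Alice announces the block W = n, of
    probability 2^-(n+1), in which X is drawn, and the key is the codeword of X
    in block W: given W, its bits are fair until it stops.  Pointwise
    2^-(W+1) 2^-|K| <= p(X), so |K| + (W + 1) >= log 1/p(X), and E[W + 1] = 2.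

    Alice must draw W given X = x from one discrete variable independent of X.
    An x coded in a block loses at least half of its remaining mass, so the law
    of W given x has, up to order, geometrically decaying atoms, uniformly in x;
    the atoms of a variable whose tail decays only like 2/(i+2) can then be
    allotted greedily, one by one, so as to realise all these laws
    simultaneously. *)

Section Esum.
Variables (R : realType) (T : choiceType).
Implicit Types (S : set T) (a : T -> R).

Lemma sub_esum S S' (f : T -> \bar R) : S `<=` S' ->
  (\esum_(x in S) f x <= \esum_(x in S') f x)%E.
Proof.
move=> SS'; apply: ereal_sup_le => _ [A [finA AS] <-].
by exists A => //; split => //; exact: subset_trans SS'.
Qed.

Lemma esum_le_seq S a (c : R) :
  (forall s, uniq s -> [set` s] `<=` S -> \sum_(x <- s) a x <= c) ->
  (\esum_(x in S) (a x)%:E <= c%:E)%E.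
Proof.
move=> sum_le; apply: ge_ereal_sup => _ [A [finA AS]] <-.
rewrite fsbig_finite//= sumEFin lee_fin sum_le// => x /=.
by rewrite in_fset_set// inE => /AS.
Qed.

Lemma seq_le_esum S a s : uniq s -> [set` s] `<=` S ->
  ((\sum_(x <- s) a x)%:E <= \esum_(x in S) (a x)%:E)%E.
Proof.
move=> uniq_s sS; apply: esum_ge; exists [set` s].
  by split => //; exact: finite_seq.
by rewrite -fsbig_seq// sumEFin.
Qed.

Lemma ge0_esumZl S (f : T -> \bar R) (c : R) :
  0 <= c -> (forall x, 0 <= f x)%E ->
  (\esum_(x in S) (c%:E * f x) = c%:E * \esum_(x in S) f x)%E.
Proof.
move=> c0 f0; rewrite /esum -ereal_supZl//; last first.
  by apply/set0P; exists 0%E, set0; [exact: fsets_set0|rewrite fsbig_set0].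
rewrite image_comp; congr ereal_sup; apply: eq_imagel => A _ /=.
by rewrite ge0_mule_fsumr.
Qed.

Lemma esum_supported1 (f : T -> \bar R) (x0 : T) : (0 <= f x0)%E ->
  (forall x, x != x0 -> f x = 0%E) -> (\esum_(x in [set: T]) f x = f x0)%E.
Proof.
move=> fx0 f_out; rewrite -(esum_set1 fx0) [RHS]esum_mkcond.
by apply: eq_esum => x _; rewrite in_set1; case: eqP => // /eqP /f_out.
Qed.

Lemma esum_fst_snd (U : choiceType) (A : set (T * U)) (f : T * U -> \bar R) :
  (forall z, 0 <= f z)%E ->
  (\esum_(z in A) f z =
   \esum_(x in [set: T]) \esum_(y in [set y | A (x, y)]) f (x, y))%E.
Proof.
move=> f0; rewrite esum_esum//.
rewrite (_ : _ `*`` _ = A); last by apply/seteqP; split => -[x y] //= [].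
by apply: eq_esum => -[].
Qed.

End Esum.

Section EsumNat.
Variables (R : realType) (P : pred nat) (a : nat -> R).
Hypothesis a_ge0 : forall i, 0 <= a i.

Lemma esum_nat_le (c : R) : (forall n, \sum_(i < n | P i) a i <= c) ->
  (\esum_(i in [set i | P i]) (a i)%:E <= c%:E)%E.
Proof.
move=> sum_le; rewrite -nneseries_esum => [|i _]; last by rewrite lee_fin.
apply: lime_le; first by apply: is_cvg_nneseries_cond => i _; rewrite lee_fin.
by apply: nearW => n; rewrite big_mkord sumEFin lee_fin.
Qed.

Lemma sum_le_esum_nat n :
  ((\sum_(i < n | P i) a i)%:E <= \esum_(i in [set i | P i]) (a i)%:E)%E.
Proof.
rewrite -nneseries_esum => [|i _]; last by rewrite lee_fin.
rewrite -sumEFin -(big_mkord P (fun i => (a i)%:E)).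
by apply: nneseries_lim_ge => i _ _; rewrite lee_fin.
Qed.

Lemma esum_nat_eq (c : R) : (forall n, \sum_(i < n | P i) a i <= c) ->
  (forall e, 0 < e -> exists n, c <= \sum_(i < n | P i) a i + e) ->
  (\esum_(i in [set i | P i]) (a i)%:E = c%:E)%E.
Proof.
move=> sum_le sum_ge; apply/le_anti; rewrite esum_nat_le//=.
apply/lee_addgt0Pr => e e0; have [n cn] := sum_ge e e0.
apply: (@le_trans _ _ ((\sum_(i < n | P i) a i)%:E + e%:E)%E).
  by rewrite -EFinD lee_fin.
by rewrite leeD2r// sum_le_esum_nat.
Qed.

End EsumNat.

Section Probability.
Variable R : realType.

Lemma PrE (T : countType) (p : T -> R) (A : set T) : is_pmf p ->
  ((Pr p A)%:E = \esum_(x in A) (p x)%:E)%E.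
Proof.
move=> [p0 p1]; rewrite /Pr fineK// ge0_fin_numE.
  by rewrite (le_lt_trans (sub_esum _ (@subsetT _ A)))// p1 ltry.
by apply: esum_ge0 => x _; rewrite lee_fin.
Qed.

Lemma Pr_setT (T : countType) (p : T -> R) : is_pmf p -> Pr p [set: T] = 1.
Proof. by move=> [_ p1]; rewrite /Pr p1. Qed.

Lemma le_Pr (T : countType) (p : T -> R) (A B : set T) : is_pmf p ->
  A `<=` B -> Pr p A <= Pr p B.
Proof. by move=> p_pmf AB; rewrite -lee_fin !PrE// sub_esum. Qed.

Lemma Pr_set1 (T : countType) (p : T -> R) x : is_pmf p -> Pr p [set x] = p x.
Proof. by move=> [p0 _]; rewrite /Pr esum_set1 ?lee_fin. Qed.

Lemma Pr_set0 (T : countType) (p : T -> R) : Pr p set0 = 0.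
Proof. by rewrite /Pr esum_set0. Qed.

Lemma pmf_le1 (T : countType) (p : T -> R) x : is_pmf p -> p x <= 1.
Proof. by move=> p_pmf; rewrite -(Pr_set1 x p_pmf) -(Pr_setT p_pmf) le_Pr. Qed.

Lemma neg_log2_ge0 (x : R) : x <= 1 -> 0 <= - log2 x.
Proof.
move=> x1; rewrite oppr_ge0 /log2 mulr_le0_ge0 ?invr_ge0//; first exact: ln_le0.
by rewrite ln_ge0// ler1n.
Qed.

Lemma neg_log2_le (m : nat) (x : R) : 2 ^- m <= x -> - log2 x <= m%:R.
Proof.
have pow_gt0 : 0 < 2 ^- m :> R by rewrite invr_gt0 exprn_gt0.
move=> le_x; have := le_x; rewrite -ler_ln ?posrE ?(lt_le_trans pow_gt0)//.
rewrite lnV ?posrE ?exprn_gt0// lnXn// -[_ *+ m]mulr_natl => le_ln.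
by rewrite lerNl ler_pdivlMr ?ln_gt0 ?ltr1n// mulNr.
Qed.

End Probability.

Section ProductPmf.
Variables (R : realType) (T U : countType) (p : T -> R) (q : U -> R).
Hypotheses (p_pmf : is_pmf p) (q_pmf : is_pmf q).

Definition prod_pmf (z : T * U) : R := p z.1 * q z.2.

Lemma prod_pmf_ge0 z : 0 <= prod_pmf z.
Proof. by rewrite mulr_ge0//; [case: p_pmf|case: q_pmf]. Qed.

Lemma esum_prod_pmf (f : T -> R) (A : set (T * U)) : (forall x, 0 <= f x) ->
  (\esum_(z in A) (f z.1 * prod_pmf z)%:E =
   \esum_(x in [set: T]) (f x * (p x * Pr q [set u | A (x, u)]))%:E)%E.
Proof.
move=> f0; rewrite esum_fst_snd => [|z]; last first.
  by rewrite lee_fin mulr_ge0// prod_pmf_ge0.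
have [[p0 _] [q0 _]] := (p_pmf, q_pmf).
apply: eq_esum => x _; rewrite mulrA EFinM PrE// -ge0_esumZl ?mulr_ge0//.
by apply: eq_esum => u _; rewrite -EFinM -mulrA.
Qed.

Lemma esum_prod_pmf1 (A : set (T * U)) : (\esum_(z in A) (prod_pmf z)%:E =
  \esum_(x in [set: T]) (p x * Pr q [set u | A (x, u)])%:E)%E.
Proof.
under eq_esum do rewrite -[prod_pmf _]mul1r.
by rewrite (esum_prod_pmf (f := fun=> 1))//; under eq_esum do rewrite mul1r.
Qed.

Lemma prod_pmf_is_pmf : is_pmf prod_pmf.
Proof.
split; first exact: prod_pmf_ge0.
rewrite esum_prod_pmf1 -p_pmf.2; apply: eq_esum => x _.
by rewrite (_ : [set u | _] = setT)// Pr_setT// mulr1.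
Qed.

Lemma Pr_prod_pmf (A : set (T * U)) : ((Pr prod_pmf A)%:E =
  \esum_(x in [set: T]) (p x * Pr q [set u | A (x, u)])%:E)%E.
Proof. by rewrite PrE ?esum_prod_pmf1//; exact: prod_pmf_is_pmf. Qed.

Lemma Pr_prod_setX (A : set T) (B : set U) :
  Pr prod_pmf (A `*` B) = Pr p A * Pr q B.
Proof.
apply: EFin_inj; rewrite Pr_prod_pmf EFinM PrE// [in RHS]muleC.
have PrB : 0 <= Pr q B by rewrite -(Pr_set0 q) le_Pr.
rewrite -ge0_esumZl => [||x]; rewrite ?lee_fin//; last by case: p_pmf.
rewrite [RHS]esum_mkcond; apply: eq_esum => x _; case: ifPn => [/set_mem Ax|xA].
  rewrite -EFinM mulrC; congr (Pr q _ * _)%:E.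
  by apply/seteqP; split => u //= [].
rewrite (_ : [set u | _] = set0) ?Pr_set0 ?mulr0//.
by apply/seteqP; split => u // -[/mem_set]; rewrite (negPf xA).
Qed.

End ProductPmf.

(** * Complete prefix codes *)

Section Exp2N.
Variable R : realType.

Lemma exp2N_ge0 n : 0 <= 2 ^- n :> R.
Proof. by rewrite invr_ge0 exprn_ge0. Qed.

Lemma exp2N_half n : 2 ^- n = 2 ^- n.+1 + 2 ^- n.+1 :> R.
Proof. by rewrite exprS; field; rewrite expf_neq0. Qed.

Lemma exp2N_le (e : R) : 0 < e -> exists n, 2 ^- n <= e.
Proof.
move=> e0; exists (Num.bound e^-1).
rewrite -[leRHS]invrK lef_pV2 ?posrE ?exprn_gt0 ?invr_gt0//.
by rewrite ltW ?upper_nthrootP.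
Qed.

End Exp2N.

Definition cylinder (v : seq bool) : set (seq bool) := [set s | prefix v s].

Definition prefix_free (C : set (seq bool)) : Prop :=
  forall s t, C s -> C t -> prefix s t -> s = t.

Definition kraft_sum (R : realType) (T : choiceType) (D : set T)
    (l : T -> nat) : \bar R :=
  \esum_(x in D) (2 ^- l x)%:E.

Definition complete_prefix_code (R : realType) (C : set (seq bool)) : Prop :=
  prefix_free C /\ kraft_sum R C size = 1%E.

Section KraftSum.
Variables (R : realType) (T U : choiceType).

Lemma kraft_sum_ge0 (D : set T) (l : T -> nat) : (0 <= kraft_sum R D l)%E.
Proof. by apply: esum_ge0 => x _; rewrite lee_fin exp2N_ge0. Qed.

Lemma kraft_sum_set1 x (l : T -> nat) :
  kraft_sum R [set x] l = (2 ^- l x)%:E.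
Proof. by rewrite /kraft_sum esum_set1// lee_fin exp2N_ge0. Qed.

Lemma kraft_sum_image (D : set T) (e : T -> U) (l : U -> nat) :
  set_inj D e -> kraft_sum R (e @` D) l = kraft_sum R D (l \o e).
Proof. by move=> e_inj; rewrite /kraft_sum esum_image. Qed.

End KraftSum.

Lemma prefix_rconsE (v s : seq bool) b : prefix (rcons v b) s =
  [&& size v < size s, prefix v s & nth false s (size v) == b]%N.
Proof.
have [vs|sv] /= := ltnP (size v) (size s).
  by rewrite !prefixE size_rcons (take_nth false vs) eqseq_rcons.
by apply/negbTE; apply: contraL sv => /size_prefix; rewrite size_rcons -ltnNge.
Qed.

Lemma proper_prefix_size (v s : seq bool) :
  prefix v s -> s != v -> (size v < size s)%N.
Proof.
move=> vs; rewrite ltnNge; apply: contraNN => sv.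
by rewrite -(take_oversize sv) -prefixE.
Qed.

Lemma cylinder_nil : cylinder [::] = setT.
Proof. by apply/seteqP; split => s // _; exact: prefix0s. Qed.

Lemma cylinder_rcons v b : cylinder (rcons v b) =
  (cylinder v `\ v) `&` [set s | nth false s (size v) = b].
Proof.
apply/seteqP; split => s; rewrite /cylinder /= prefix_rconsE.
  move=> /and3P[vs pvs /eqP sb]; split => //; split => // sv.
  by rewrite sv ltnn in vs.
by move=> [[pvs /eqP sv] /eqP sb]; rewrite proper_prefix_size// pvs.
Qed.

Lemma prefix_of_rcons (t v : seq bool) b :
  prefix t (rcons v b) -> t != rcons v b -> prefix t v.
Proof.
move=> tvb; rewrite eq_sym => /(proper_prefix_size tvb).
rewrite size_rcons ltnS => tv; move: tvb.
by rewrite !prefixE -cats1 takel_cat.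
Qed.

Section Kraft.
Variable R : realType.
Implicit Types (C : set (seq bool)) (v : seq bool).
Local Notation code_mass C := (kraft_sum R C size).

Lemma kraft_sum_proper_cylinder C v : code_mass (C `&` (cylinder v `\ v)) =
  (code_mass (C `&` cylinder (rcons v false)) +
   code_mass (C `&` cylinder (rcons v true)))%E.
Proof.
pose zero_next := [set s | nth false s (size v) = false].
rewrite {1}/kraft_sum (esumID zero_next); last first.
  by move=> s _; rewrite lee_fin exp2N_ge0.
rewrite (_ : ~` _ = [set s | nth false s (size v) = true]); last first.
  by apply/seteqP; split => s; rewrite /zero_next /=; case: nth.
by rewrite !cylinder_rcons !setIA.
Qed.

Lemma kraft_sum_cylinder C v : ~ C v -> code_mass (C `&` cylinder v) =
  (code_mass (C `&` cylinder (rcons v false)) +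
   code_mass (C `&` cylinder (rcons v true)))%E.
Proof.
move=> vC; rewrite -kraft_sum_proper_cylinder; congr (kraft_sum R _ _).
apply/seteqP; split => s [Cs]; last by case.
by move=> vs; do 2!split => //; move=> sv; apply: vC; rewrite -sv.
Qed.

Lemma prefix_free_cylinder C v :
  prefix_free C -> C v -> C `&` cylinder v = [set v].
Proof.
move=> C_pf Cv; apply/seteqP; split => [s [Cs vs]|_ ->]; first exact/esym/C_pf.
by split => //; exact: prefix_refl.
Qed.

Lemma kraft_inequality_bounded C d v : prefix_free C ->
  (forall s, C s -> (size s <= size v + d)%N) ->
  (code_mass (C `&` cylinder v) <= (2 ^- size v)%:E)%E.
Proof.
move=> C_pf; elim: d v => [|d IH] v size_le.
all: have [Cv|vC] := pselect (C v).
1,3: by rewrite prefix_free_cylinder ?kraft_sum_set1.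
- rewrite /kraft_sum esum1 ?lee_fin ?exp2N_ge0// => s [Cs vs]; case: vC.
  have sv : (size s <= size v)%N by rewrite -[size v]addn0 size_le.
  by move: vs; rewrite /cylinder /= prefixE take_oversize// => /eqP <-.
- have IHv b :
      (code_mass (C `&` cylinder (rcons v b)) <= (2 ^- (size v).+1)%:E)%E.
    by rewrite -(size_rcons v b) IH// => s /size_le; rewrite size_rcons addSnnS.
  by rewrite kraft_sum_cylinder// exp2N_half EFinD leeD.
Qed.

Lemma kraft_inequality C v : prefix_free C ->
  (code_mass (C `&` cylinder v) <= (2 ^- size v)%:E)%E.
Proof.
move=> C_pf; apply: esum_le_seq => L uniq_L LC.
have LD : [set` L] `<=` [set` L] `&` cylinder v.
  by move=> s Ls; split => //; have [] := LC s Ls.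
rewrite -lee_fin (le_trans (seq_le_esum _ uniq_L LD))//.
pose d := \max_(s <- L) size s.
apply: (@kraft_inequality_bounded _ d) => [s t /LC[Cs _] /LC[Ct _]|s sL].
  exact: C_pf.
by apply: leq_trans (leq_addl _ _); exact: (@leq_bigmax_seq _ L xpredT size).
Qed.

Lemma kraft_sum_le1 C : prefix_free C -> (code_mass C <= 1)%E.
Proof.
by move=> /(kraft_inequality [::]); rewrite cylinder_nil setIT expr0 invr1.
Qed.

Lemma complete_cylinder C v : complete_prefix_code R C ->
  (forall s, C s -> prefix s v -> s = v) ->
  code_mass (C `&` cylinder v) = (2 ^- size v)%:E.
Proof.
move=> [C_pf C1]; elim/last_ind: v => [|v b IH] v_top.
  by rewrite cylinder_nil setIT C1 expr0 invr1.
have no_prefix s : C s -> prefix s v -> False.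
  move=> Cs sv; have := v_top _ Cs (prefix_trans sv (prefix_rcons _ _)).
  by move=> sE; have := size_prefix sv; rewrite sE size_rcons ltnn.
have vC : ~ C v by move=> /no_prefix; apply; exact: prefix_refl.
have := IH (fun s Cs sv => match no_prefix s Cs sv with end).
have := kraft_inequality (rcons v false) C_pf.
have := kraft_inequality (rcons v true) C_pf.
have := kraft_sum_ge0 R (C `&` cylinder (rcons v true)) size.
have := kraft_sum_ge0 R (C `&` cylinder (rcons v false)) size.
rewrite (kraft_sum_cylinder vC) !size_rcons exp2N_half.
case: b {v_top}.
all: case: (code_mass (C `&` cylinder (rcons v true))) => [x| |] //.
all: case: (code_mass _) => [y| |] //.
all: by rewrite -EFinD !lee_fin => ? ? ? ? [?]; congr EFin; lra.
Qed.

Lemma complete_proper_cylinder C v : complete_prefix_code R C ->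
  (exists2 s, C s & (cylinder v `\ v) s) ->
  code_mass (C `&` (cylinder v `\ v)) = (2 ^- size v)%:E /\
  forall b, code_mass (C `&` cylinder (rcons v b)) = (2 ^- (size v).+1)%:E.
Proof.
move=> C_complete [s Cs [vs sv]].
have no_prefix t : C t -> prefix t v -> False.
  move=> Ct tv; apply: sv.
  have ts := C_complete.1 _ _ Ct Cs (prefix_trans tv vs).
  apply/eqP/negPn/negP => /(proper_prefix_size vs).
  by rewrite -ts ltnNge size_prefix.
have half b : code_mass (C `&` cylinder (rcons v b)) = (2 ^- (size v).+1)%:E.
  rewrite complete_cylinder ?size_rcons// => t Ct tvb.
  apply/eqP/negPn/negP => t_neq.
  exact: no_prefix Ct (prefix_of_rcons tvb t_neq).
by split=> //; rewrite kraft_sum_proper_cylinder !half -EFinD -exp2N_half.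
Qed.

Lemma complete_prefix_code_randomly_stopped C (q : seq bool -> R) :
  complete_prefix_code R C ->
  (forall s, q s = if s \in C then 2 ^- size s else 0) -> randomly_stopped q.
Proof.
move=> C_complete qE n k + kn; rewrite -kn {n kn}; case/lastP: k => // v b _ /=.
rewrite size_rcons nth_rcons ltnn eqxx -cats1 take_size_cat//=.
have PrE A : Pr q A = fine (code_mass (C `&` A)).
  rewrite /Pr /kraft_sum esum_mkcondl; congr fine; apply: eq_esum => s _.
  by rewrite qE; case: ifP.
rewrite (_ : [set s | _ /\ _] = cylinder v `\ v); last first.
  apply/seteqP; split => s /=.
    move=> [vs sv]; rewrite /cylinder /= prefixE sv; split => // s_eq.
    by rewrite s_eq ltnn in vs.
  move=> [vs /eqP sv]; rewrite proper_prefix_size//; split=> //.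
  by apply/eqP; rewrite -prefixE.
rewrite -cylinder_rcons !PrE => pos.
have [|-> ->] := complete_proper_cylinder (v := v) C_complete.
  apply: contrapT => none; move: pos; rewrite /kraft_sum esum1 ?ltxx//.
  by move=> s [Cs vs]; case: none; exists s.
by rewrite /= exprS; field; rewrite expf_neq0.
Qed.

End Kraft.

(** * Codes with prescribed word lengths *)

Fixpoint binary_word (l N : nat) : seq bool :=
  if l is l'.+1 then rcons (binary_word l' N./2) (odd N) else [::].

Lemma size_binary_word l N : size (binary_word l N) = l.
Proof. by elim: l N => //= l IH N; rewrite size_rcons IH. Qed.

Lemma binary_word_inj l M N : (M < 2 ^ l)%N -> (N < 2 ^ l)%N ->
  binary_word l M = binary_word l N -> M = N.
Proof.
elim: l M N => [|l IH] M N.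
  by rewrite expn0 !ltnS !leqn0 => /eqP -> /eqP ->.
rewrite expnS => M_lt N_lt /= /rcons_inj[/IH half_eq odd_eq].
by rewrite -[M]odd_double_half -[N]odd_double_half odd_eq half_eq//; lia.
Qed.

Lemma take_binary_word l e N :
  take l (binary_word (l + e) N) = binary_word l (N %/ 2 ^ e).
Proof.
elim: e N => [|e IH] N.
  by rewrite addn0 divn1 take_oversize ?size_binary_word.
rewrite addnS /= -cats1 takel_cat ?size_binary_word ?leq_addr// IH.
by rewrite -divn2 -divnMA expnS.
Qed.

Lemma prefix_binary_word l m M N :
  (l <= m)%N -> (M < 2 ^ l)%N -> (N < 2 ^ m)%N ->
  prefix (binary_word l M) (binary_word m N) -> M = (N %/ 2 ^ (m - l))%N.
Proof.
move=> lm M_lt N_lt; rewrite prefixE size_binary_word.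
rewrite -[in X in take l X](subnKC lm) take_binary_word => /eqP/esym.
by apply: binary_word_inj => //; rewrite ltn_divLR ?expn_gt0// -expnD subnKC.
Qed.

Section SortedCode.
Variables (R : realType) (D : pred nat) (l : nat -> nat).
Hypothesis l_mono : {in D &, {homo l : i j / (i <= j)%N}}.

(* The mass of the preceding items in units of 2^-(l n): the word of n spells
   the binary expansion of that partial sum. *)
Definition offset n := (\sum_(0 <= j < n | D j) 2 ^ (l n - l j))%N.
Definition sorted_word n := binary_word (l n) (offset n).
Definition fits : pred nat := [pred n | D n && (offset n < 2 ^ l n)%N].

Lemma offset_step i j : i \in D -> j \in D -> (i < j)%N ->
  ((offset i).+1 * 2 ^ (l j - l i) <= offset j)%N.
Proof.
move=> Di Dj ij; rewrite /offset [leqRHS](big_cat_nat (n := i.+1))//=.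
rewrite [X in (_ <= X + _)%N]big_mkcond big_nat_recr//= -big_mkcond /= ifT//.
apply: leq_trans (leq_addr _ _); rewrite mulSn addnC leq_add2r big_distrl /=.
rewrite [leqLHS]big_nat_cond [leqRHS]big_nat_cond leq_sum// => k /andP[ki Dk].
have := l_mono Dk Di (ltnW ki); have := l_mono Di Dj (ltnW ij).
by rewrite -expnD leq_exp2l//; lia.
Qed.

Lemma natr_offset n : n \in D ->
  (offset n)%:R = 2 ^+ l n * \sum_(j < n | D j) 2 ^- l j :> R.
Proof.
move=> Dn; rewrite /offset big_mkord natr_sum mulr_sumr; apply: eq_bigr => j Dj.
by rewrite natrX exprB ?unitfE ?l_mono// ltnW.
Qed.

Lemma sorted_word_prefix_eq i j : fits i -> fits j ->
  prefix (sorted_word i) (sorted_word j) -> i = j.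
Proof.
move=> /andP[Di i_fits] /andP[Dj j_fits] pij.
have lij : (l i <= l j)%N by have := size_prefix pij; rewrite !size_binary_word.
have := prefix_binary_word lij i_fits j_fits pij.
case: (ltngtP i j) => // lt_ij offsetE; exfalso.
  have := offset_step Di Dj lt_ij.
  by rewrite -leq_divRL ?expn_gt0// -offsetE ltnn.
have := offset_step Dj Di lt_ij; rewrite offsetE.
have -> : l j = l i by apply/eqP; rewrite eqn_leq lij l_mono// ltnW.
by rewrite subnn muln1 divn1 ltnn.
Qed.

Lemma kraft_sum_sorted_word :
  kraft_sum R (sorted_word @` [set i | fits i]) size =
  kraft_sum R [set i | fits i] l.
Proof.
rewrite kraft_sum_image => [|i j].
  by apply: eq_esum => i _; rewrite /= size_binary_word.
rewrite !inE => i_fits j_fits ij; apply: sorted_word_prefix_eq => //.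
by rewrite ij prefix_refl.
Qed.

(* The first item that does not fit is preceded by a mass of at least 1. *)
Lemma fits_mass_ge1 : (1 <= kraft_sum R [set i | D i] l)%E ->
  (1 <= kraft_sum R [set i | fits i] l)%E.
Proof.
move=> D_ge1.
have [|all_fit] := pselect (exists n, D n && ~~ fits n); last first.
  rewrite (_ : [set i | fits i] = [set i | D i])//.
  apply/seteqP; split => n /=; first by case/andP.
  move=> Dn; apply/negPn/negP => n_fits.
  by apply: all_fit; exists n; apply/andP.
move=> /ex_minnP[n /andP[Dn n_fits] n_min].
have n_overflow : (2 ^ l n <= offset n)%N.
  by move: n_fits; rewrite /fits /= Dn -leqNgt.
have before_ge1 : 1 <= \sum_(j < n | D j) 2 ^- l j :> R.
  rewrite -(ler_pM2l (exprn_gt0 (l n) (ltr0Sn R 1))) mulr1 -natr_offset//.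
  by rewrite -natrX ler_nat.
apply: le_trans (sum_le_esum_nat fits (fun i => exp2N_ge0 R (l i)) n).
rewrite lee_fin (le_trans before_ge1)//.
rewrite (eq_bigl (fun j : 'I_n => fits j))// => j.
apply/idP/idP => [Dj|/andP[]//]; apply/negPn/negP => j_fits.
by have := n_min j; rewrite Dj j_fits leqNgt ltn_ord => /(_ isT).
Qed.

Lemma sorted_word_complete : (1 <= kraft_sum R [set i | D i] l)%E ->
  complete_prefix_code R (sorted_word @` [set i | fits i]).
Proof.
move=> D_ge1; have pf : prefix_free (sorted_word @` [set i | fits i]).
  by move=> _ _ [i i_fits <-] [j j_fits <-] /sorted_word_prefix_eq ->.
split=> //; apply/le_anti; rewrite kraft_sum_le1//=.
by rewrite kraft_sum_sorted_word fits_mass_ge1.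
Qed.

End SortedCode.

Section LevelSets.
Variables (T : countType) (D : set T) (l : T -> nat).

Lemma finite_kraft_level (R : realType) (c : R) m :
  (kraft_sum R D l <= c%:E)%E -> finite_set (D `&` l @^-1` [set m]).
Proof.
move=> sum_le; apply: contrapT => /infinite_set_fset.
move=> /(_ (Num.truncn (c * 2 ^+ m)).+1)[B BD]; apply/negP; rewrite -ltnNge.
rewrite ltnS.
have : \sum_(x <- finmap.enum_fset B) (2 ^- m : R) <= c.
  rewrite -lee_fin (le_trans _ sum_le)//.
  rewrite (eq_big_seq (fun x => 2 ^- l x)); last by move=> x /BD[_ ->].
  by apply: seq_le_esum => // x /BD[].
rewrite big_const_seq count_predT iter_addr_0 -[_ *+ _]mulr_natl.
rewrite ler_pdivrMr ?exprn_gt0// => card_le.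
by rewrite truncn_ge_nat// (le_trans _ card_le).
Qed.

Lemma sorting_rank : (forall m, finite_set (D `&` l @^-1` [set m])) ->
  exists2 rank : T -> nat, set_inj D rank &
    forall x y, D x -> D y -> (l x < l y)%N -> (rank x < rank y)%N.
Proof.
move=> fin_level.
pose level m := finmap.enum_fset (fset_set (D `&` l @^-1` [set m])).
have mem_level x : D x -> x \in level (l x).
  by move=> Dx; rewrite in_fset_set ?inE.
pose rank x := (\sum_(0 <= m < l x) size (level m) + index x (level (l x)))%N.
have rank_mono x y : D x -> D y -> (l x < l y)%N -> (rank x < rank y)%N.
  move=> Dx _ lxy; apply: leq_trans (leq_addr _ _).
  rewrite (big_cat_nat (n := (l x).+1))//=; apply: leq_trans (leq_addr _ _).
  by rewrite big_nat_recr//= -addnS leq_add2l index_mem mem_level.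
exists rank => // x y /set_mem Dx /set_mem Dy rank_eq.
have [lxy|lyx|lxy] := ltngtP (l x) (l y).
- by have := rank_mono _ _ Dx Dy lxy; rewrite rank_eq ltnn.
- by have := rank_mono _ _ Dy Dx lyx; rewrite rank_eq ltnn.
move: rank_eq (mem_level _ Dx) (mem_level _ Dy); rewrite /rank lxy => /addnI.
by move=> index_eq xL yL; rewrite -(nth_index x xL) index_eq nth_index.
Qed.

End LevelSets.

Record codebook (T : Type) := Codebook { coded : set T; word :> T -> seq bool }.

Definition complete_codebook (R : realType) (T : choiceType)
    (B : codebook T) : Prop :=
  set_inj (coded B) B /\ complete_prefix_code R (B @` coded B).

Lemma exists_complete_codebook (R : realType) (T : countType) (D : set T)
    (l : T -> nat) (c : R) :
  (1 <= kraft_sum R D l)%E ->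
  (kraft_sum R D l <= c%:E)%E ->
  exists2 B : codebook T, complete_codebook R B &
    forall x, coded B x -> D x /\ size (B x) = l x.
Proof.
move=> ge1 le_c.
have [rank rank_inj rank_mono] :=
  sorting_rank (fun m => finite_kraft_level m le_c).
have /choice[l' l'_rank] j : exists m, forall x, D x -> rank x = j -> l x = m.
  have [[x Dx <-]|none] := pselect ((rank @` D) j).
    by exists (l x) => y Dy /rank_inj ->//; rewrite inE.
  by exists 0%N => x Dx xj; case: none; exists x.
have l'E x : D x -> l' (rank x) = l x by move=> Dx; rewrite -(l'_rank _ x Dx).
pose D' j := `[< (rank @` D) j >].
have l'_mono : {in D' &, {homo l' : i j / (i <= j)%N}}.
  move=> _ _ /asboolP[x Dx <-] /asboolP[y Dy <-]; rewrite !l'E//.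
  by apply: contraTT; rewrite -!ltnNge; exact: rank_mono.
pose B :=
  Codebook [set x | D x /\ fits D' l' (rank x)] (sorted_word D' l' \o rank).
have BE : B @` coded B = sorted_word D' l' @` [set j | fits D' l' j].
  apply/seteqP; split => [_ [x [Dx x_fits] <-]|_ [j j_fits <-]].
    by exists (rank x).
  have /andP[/asboolP[x Dx xj] _] := j_fits.
  by exists x; rewrite /= xj.
exists B; last by move=> x [Dx _]; split => //; rewrite size_binary_word l'E.
split; last first.
  rewrite BE; apply: sorted_word_complete => //.
  rewrite (_ : [set j | D' j] = rank @` D); last first.
    by apply/seteqP; split => j /asboolP.
  rewrite kraft_sum_image// [kraft_sum _ _ _](_ : _ = kraft_sum R D l)//.
  by apply: eq_esum => x /l'E /= ->.
move=> x y; rewrite !inE => -[Dx x_fits] [Dy y_fits] xy.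
apply: rank_inj; rewrite ?inE//; apply: (sorted_word_prefix_eq l'_mono) => //.
by rewrite [sorted_word _ _ _]xy prefix_refl.
Qed.

(** * Dyadic decomposition of a distribution *)

Definition weight (R : realType) (T : choiceType) (B : codebook T) x : R :=
  if x \in coded B then 2 ^- size (B x) else 0.

Section Weight.
Variables (R : realType) (T : choiceType) (B : codebook T).

Lemma weight_ge0 x : 0 <= weight R B x.
Proof. by rewrite /weight; case: ifP => // _; exact: exp2N_ge0. Qed.

Lemma weight_coded x : coded B x -> weight R B x = 2 ^- size (B x).
Proof. by rewrite /weight => /mem_set ->. Qed.

Lemma weight_uncoded x : ~ coded B x -> weight R B x = 0.
Proof. by rewrite /weight => xB; rewrite memNset. Qed.

Lemma esum_weight : complete_codebook R B ->
  (\esum_(x in [set: T]) (weight R B x)%:E = 1)%E.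
Proof.
move=> [B_inj [_ <-]]; rewrite kraft_sum_image// [RHS]esum_mkcond.
by apply: eq_esum => x _; rewrite /weight; case: ifP.
Qed.

End Weight.

Lemma dyadic_bracket (R : realType) (x : R) : 0 < x <= 1 ->
  exists n, x <= 2 ^- n <= 2 * x.
Proof.
move=> /andP[x_gt0 x_le1].
have [n n_le n_min] := ex_minnP (exp2N_le (mulr_gt0 (ltr0Sn R 1) x_gt0)).
exists n; rewrite n_le andbT.
case: n {n_le} n_min => [|n] n_min; first by rewrite invr1.
rewrite leNgt; apply/negP => lt_x.
have : 2 ^- n <= 2 * x by rewrite exp2N_half; lra.
by move=> /n_min; rewrite ltnn.
Qed.

Section DyadicDecomposition.
Variables (R : realType) (T : countType).

(* Rounding p up to powers of two gives total mass at least 1, so the largest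
   rounded atoms carry a complete prefix code. *)
Lemma dyadic_layer (p : T -> R) : is_pmf p ->
  exists2 B : codebook T, complete_codebook R B &
    forall x, weight R B x <= 2 * p x /\ (coded B x -> p x <= weight R B x).
Proof.
move=> p_pmf; have [p_ge0 p_sum1] := p_pmf; pose D := [set x | 0 < p x].
have /choice[l lP] x : exists n, D x -> p x <= 2 ^- n <= 2 * p x.
  have [px|] := pselect (D x); last by exists 0%N.
  have /dyadic_bracket[n nP] : 0 < p x <= 1 by rewrite pmf_le1// andbT.
  by exists n.
have D_sum : (\esum_(x in D) (p x)%:E = 1)%E.
  rewrite -p_sum1 esum_mkcond; apply: eq_esum => x _; case: ifPn => // xD.
  congr EFin; apply/le_anti; rewrite p_ge0 /= leNgt; apply: contraNN xD.
  exact: mem_set.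
have ge1 : (1 <= kraft_sum R D l)%E.
  by rewrite -D_sum; apply: le_esum => x /lP /andP[le_l _]; rewrite lee_fin.
have le2 : (kraft_sum R D l <= 2%:E)%E.
  rewrite -[leRHS]mule1 -D_sum -ge0_esumZl//.
  by apply: le_esum => x /lP /andP[_ l_le]; rewrite -EFinM lee_fin.
have [B B_complete B_D] := exists_complete_codebook ge1 le2; exists B => // x.
have [xB|xB] := pselect (coded B x); last first.
  by split => //; rewrite weight_uncoded// mulr_ge0.
by rewrite weight_coded//; have [/lP/andP[? ?] ->] := B_D x xB.
Qed.

Definition residual (p : T -> R) (B : codebook T) x : R :=
  2 * p x - weight R B x.

Lemma residual_pmf (p : T -> R) (B : codebook T) :
  is_pmf p -> complete_codebook R B -> (forall x, weight R B x <= 2 * p x) ->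
  is_pmf (residual p B).
Proof.
move=> [p_ge0 p_sum1] B_complete w_le.
have r_ge0 x : 0 <= residual p B x by rewrite subr_ge0.
split=> //; have : (\esum_(x in [set: T]) (2 * p x)%:E = 1 + 1)%E.
  under eq_esum do rewrite EFinM.
  by rewrite ge0_esumZl// p_sum1 mule1.
have resE x : 2 * p x = residual p B x + weight R B x by rewrite subrK.
under eq_esum do rewrite resE EFinD.
rewrite esumD; try by move=> x _; rewrite lee_fin ?weight_ge0.
rewrite esum_weight//; case: (esum _ _) => [y| |] //.
by rewrite -!EFinD => -[/addIr ->].
Qed.

(* p = w_0 / 2 + w_1 / 4 + ... + w_n / 2^(n+1) + f_(n+1) / 2^(n+1), where w_i is
   the weight of the i-th codebook. *)
Lemma dyadic_decomposition (p : T -> R) : is_pmf p ->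
  exists (B : nat -> codebook T) (f : nat -> T -> R), [/\
    f 0%N = p, forall n, is_pmf (f n),
    forall n, f n.+1 = residual (f n) (B n),
    forall n x, coded (B n) x -> f n x <= weight R (B n) x &
    forall n, complete_codebook R (B n)].
Proof.
move=> p_pmf; have /choice[layer layerP] (f : T -> R) : exists B : codebook T,
    is_pmf f -> complete_codebook R B /\
    forall x, weight R B x <= 2 * f x /\ (coded B x -> f x <= weight R B x).
  have [/dyadic_layer[B B_complete Bf]|] := pselect (is_pmf f).
    by exists B.
  by exists (Codebook set0 (fun=> [::])).
pose f := fix f n := if n is m.+1 then residual (f m) (layer (f m)) else p.
have f_pmf n : is_pmf (f n).
  elim: n => //= n /[dup] fn /layerP[B_complete Bf].
  by apply: residual_pmf => // x; have [] := Bf x.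
exists (layer \o f), f.
split=> // n; have [B_complete Bf] := layerP _ (f_pmf n) => //.
by move=> x; have [] := Bf x.
Qed.

End DyadicDecomposition.

(** * Simulating halving distributions from one discrete variable *)

Section GreedyAllocation.
Variables (R : realType) (a d : nat -> R).
Hypothesis a_ge0 : forall i, 0 <= a i.
Hypothesis a_sum : forall e : R, 0 < e -> exists i, 1 <= \sum_(j < i) a j + e.
Hypothesis d_ge0 : forall n, 0 <= d n.
Hypothesis d_sum : forall m, \sum_(n < m) d n <= 1.
(* If no bin had room for the i-th atom, less than a i would be left in each
   bin in use, so the first m bins would hold more than the atoms placed. *)
Hypothesis bins_roomy : forall i, exists m,
  \sum_(j < i) a j + (\sum_(n < m) (d n != 0%R))%:R * a i < \sum_(n < m) d n.

Definition choose_bin i (room : nat -> R) : nat :=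
  xget 0%N [set n | a i <= room n].

Fixpoint room (i : nat) : nat -> R :=
  if i is j.+1 then
    fun n => room j n - (if choose_bin j (room j) == n then a j else 0)
  else d.

Definition bin i := choose_bin i (room i).

Lemma roomE i n : room i n = d n - \sum_(j < i | bin j == n) a j.
Proof.
elim: i => [|i IH] /=; first by rewrite big_ord0 subr0.
rewrite [in RHS]big_mkcond big_ord_recr /= -big_mkcond IH -/(bin i).
by rewrite opprD addrA.
Qed.

Lemma sum_room i m :
  \sum_(n < m) room i n = \sum_(n < m) d n - \sum_(j < i | (bin j < m)%N) a j.
Proof.
under eq_bigr do rewrite roomE; rewrite sumrB; congr (_ - _).
under eq_bigr do rewrite big_mkcond /=; rewrite exchange_big [RHS]big_mkcond /=.
apply: eq_bigr => j _; rewrite -big_mkcond /=; case: ifPn => [bin_lt|bin_ge].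
  by rewrite (big_pred1 (Ordinal bin_lt)) => // n; rewrite -val_eqE eq_sym.
by rewrite big_pred0// => n; apply: contraNF bin_ge => /eqP ->.
Qed.

Lemma room_le_capacity i n : room i n <= d n.
Proof. by rewrite roomE gerBl sumr_ge0. Qed.

Lemma exists_room i : (forall n, 0 <= room i n) -> exists n, a i <= room i n.
Proof.
move=> room_ge0; have [m] := bins_roomy i; rewrite ltNge => /negP m_roomy.
apply: contrapT => full; apply: m_roomy.
have room_lt n : room i n < a i.
  by rewrite ltNge; apply/negP => fit; apply: full; exists n.
have : \sum_(n < m) room i n <= (\sum_(n < m) (d n != 0%R))%:R * a i.
  rewrite natr_sum mulr_suml ler_sum// => n _.
  case: eqVneq => [dn|_] /=; last by rewrite mul1r ltW.
  by rewrite mul0r -dn room_le_capacity.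
have : \sum_(j < i | (bin j < m)%N) a j <= \sum_(j < i) a j.
  by rewrite big_mkcond ler_sum// => j _; case: ifP.
by rewrite sum_room; lra.
Qed.

Lemma room_ge0 i n : 0 <= room i n.
Proof.
elim: i n => //= i IH n; case: eqP => [<-|_]; last by rewrite subr0.
by rewrite subr_ge0; exact: (xgetPex 0%N (exists_room IH)).
Qed.

Lemma room_le_tail i n : room i n <= 1 - \sum_(j < i) a j.
Proof.
pose m := maxn n.+1 (\max_(j < i) bin j).+1.
have nm : (n < m)%N by exact: leq_maxl.
apply: (@le_trans _ _ (\sum_(k < m) room i k)).
  by rewrite (bigD1 (Ordinal nm))//= lerDl sumr_ge0// => k _; exact: room_ge0.
rewrite sum_room [X in _ - X](eq_bigl xpredT) ?lerD2r// => j.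
by rewrite /m leq_max !ltnS (leq_bigmax (F := fun j : 'I_i => bin j)) orbT.
Qed.

Lemma greedy_allocation : exists f : nat -> nat,
  forall n, (\esum_(i in [set i | f i = n]) (a i)%:E = (d n)%:E)%E.
Proof.
exists bin => n; rewrite (_ : [set i | _] = [set i | bin i == n]); last first.
  by apply/seteqP; split => i /eqP.
apply: (esum_nat_eq (P := fun i => bin i == n)) => // [i|e /a_sum[i sum_ge]].
  by rewrite -subr_ge0 -roomE room_ge0.
by exists i; have := room_le_tail i n; rewrite roomE; lra.
Qed.

End GreedyAllocation.

Section HalvingSequence.
Variables (R : realType) (r : nat -> R).

Definition halving : Prop :=
  (forall n, 0 <= r n) /\ forall n, r n.+1 = r n \/ 2 * r n.+1 <= r n.

Hypothesis r_halving : halving.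

Let r_ge0 n : 0 <= r n. Proof. by case: r_halving. Qed.

Lemma halving_nonincreasing n : r n.+1 <= r n.
Proof. by have := r_ge0 n.+1; case: (r_halving.2 n) => [->//|]; lra. Qed.

Hypothesis r0 : r 0%N = 1.
Hypothesis r_cvg0 : forall e : R, 0 < e -> exists n, r n <= e.

Let drops m := (\sum_(n < m) (r n - r n.+1 != 0)%R)%N.

Lemma halving_le_exp2N m : r m * 2 ^+ drops m <= 1.
Proof.
elim: m => [|m IH]; first by rewrite /drops big_ord0 mulr1 r0.
rewrite /drops big_ord_recr /= -/(drops m).
case: (r_halving.2 m) => [->|half]; first by rewrite subrr eqxx addn0.
case: (_ != _); last first.
  rewrite addn0 (le_trans _ IH)// ler_wpM2r ?exprn_ge0//.
  exact: halving_nonincreasing.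
rewrite addn1 exprS mulrA [_ * 2]mulrC (le_trans _ IH)//.
by rewrite ler_wpM2r ?exprn_ge0.
Qed.

Lemma halving_few_drops i : exists2 m, r m <= 2 ^- i & (drops m <= i)%N.
Proof.
have pow_gt0 : 0 < 2 ^- i :> R by rewrite invr_gt0 exprn_gt0.
have [m rm m_min] := ex_minnP (r_cvg0 pow_gt0); exists m => //.
case: m rm m_min => [|m] _ m_min; first by rewrite /drops big_ord0.
have rm_gt : 2 ^- i < r m by rewrite ltNge; apply/negP => /m_min; rewrite ltnn.
suff : (drops m < i)%N.
  by rewrite /drops big_ord_recr /= -/(drops m); case: (_ != _) => /=; lia.
rewrite ltnNge; apply/negP => i_le; have := halving_le_exp2N m; apply/negP.
rewrite -ltNge (@lt_le_trans _ _ (r m * 2 ^+ i))//.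
  by rewrite -(@ltr_pdivrMr _ (2 ^+ i)) ?exprn_gt0// mul1r.
by rewrite ler_wpM2l ?ler_eXn2l ?ltr1n.
Qed.

End HalvingSequence.

Section Harmonic.
Variable R : realType.

(* The tail 2 / (i + 2) has to exceed i + 1 atoms plus the mass 2^-(i+1) that
   a halving law may have outside its i + 1 largest atoms. *)
Definition harmonic_pmf (i : nat) : R := 2 / (i.+2 * i.+3)%:R.

Lemma harmonic_pmf_ge0 i : 0 <= harmonic_pmf i.
Proof. by rewrite divr_ge0. Qed.

Lemma sum_harmonic_pmf n : \sum_(i < n) harmonic_pmf i = 1 - 2 / n.+2%:R.
Proof.
elim: n => [|n IH]; first by rewrite big_ord0 divff ?subrr.
rewrite big_ord_recr /= IH /harmonic_pmf natrM -(natr1 n.+2).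
by field; rewrite -natrD natr1 !pnatr_eq0.
Qed.

Lemma sum_harmonic_pmf_cvg1 (e : R) :
  0 < e -> exists n, 1 <= \sum_(i < n) harmonic_pmf i + e.
Proof.
move=> e_gt0; exists (Num.truncn (2 / e)).
rewrite sum_harmonic_pmf -addrA lerDl addrC subr_ge0.
rewrite ler_pdivrMr ?ltr0n// mulrC -ler_pdivrMr//.
by rewrite ltW// (lt_trans (truncnS_gt _))// ltr_nat.
Qed.

Lemma harmonic_pmf_is_pmf : is_pmf harmonic_pmf.
Proof.
split; first exact: harmonic_pmf_ge0.
rewrite -set_true; apply: (esum_nat_eq (P := xpredT)) => [i|n|].
- exact: harmonic_pmf_ge0.
- by rewrite sum_harmonic_pmf gerBl divr_ge0.
- exact: sum_harmonic_pmf_cvg1.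
Qed.

Lemma harmonic_roomy i :
  \sum_(j < i) harmonic_pmf j + i.+1%:R * harmonic_pmf i + 2 ^- i.+1 < 1.
Proof.
have quadratic_lt_exp : (i.+2 * i.+3 < 4 * 2 ^ i.+1)%N.
  by elim: i => // i IH; rewrite expnS; nia.
have exp2N_lt : 2 ^- i.+1 < 4 / (i.+2 * i.+3)%:R :> R.
  rewrite ltr_pdivlMr ?ltr0n// mulrC ltr_pdivrMr ?exprn_gt0//.
  by rewrite -natrX -natrM ltr_nat.
suff -> : \sum_(j < i) harmonic_pmf j + i.+1%:R * harmonic_pmf i =
    1 - 4 / (i.+2 * i.+3)%:R by rewrite -addrA gtrDl addrC subr_lt0.
rewrite sum_harmonic_pmf /harmonic_pmf natrM -(natr1 i.+2) -(natr1 i.+1).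
by field; rewrite nat1r !natr1 !pnatr_eq0.
Qed.

Lemma harmonic_simulates_unit_halving (r : nat -> R) :
  halving r -> r 0%N = 1 -> (forall e : R, 0 < e -> exists n, r n <= e) ->
  exists f : nat -> nat, forall n,
    Pr harmonic_pmf [set i | f i = n] = r n - r n.+1.
Proof.
move=> r_halving r0 r_cvg0.
have sum_drops m : \sum_(n < m) (r n - r n.+1) = 1 - r m.
  rewrite -(big_mkord xpredT (fun n => r n - r n.+1)).
  rewrite (telescope_sumr_eq (fun n => - r n))// => [|n _]; last by ring.
  by rewrite r0; ring.
have [||n|m|i|f f_law] :=
    @greedy_allocation R harmonic_pmf (fun n => r n - r n.+1).
- exact: harmonic_pmf_ge0.
- exact: sum_harmonic_pmf_cvg1.
- by rewrite subr_ge0 halving_nonincreasing.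
- by rewrite sum_drops gerBl; case: r_halving.
- have [m r_le drops_le] := halving_few_drops r_halving r0 r_cvg0 i.+1.
  exists m.
  apply: (@le_lt_trans _ _
    (\sum_(j < i) harmonic_pmf j + i.+1%:R * harmonic_pmf i)).
    by rewrite lerD2l ler_wpM2r ?harmonic_pmf_ge0// ler_nat.
  by rewrite sum_drops; have := harmonic_roomy i; lra.
- by exists f => n; rewrite /Pr f_law.
Qed.

Lemma harmonic_simulates_halving (r : nat -> R) :
  halving r -> (forall e : R, 0 < e -> exists n, r n <= e) ->
  exists f : nat -> nat, forall n,
    r 0%N * Pr harmonic_pmf [set i | f i = n] = r n - r n.+1.
Proof.
move=> /[dup] r_halving [r_ge0 r_half] r_cvg0.
have [r0_eq0|r0_neq0] := eqVneq (r 0%N) 0.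
  have r_eq0 n : r n = 0.
    elim: n => // n rn; apply/le_anti.
    by rewrite r_ge0 -rn halving_nonincreasing.
  by exists id => n; rewrite !r_eq0 mul0r subrr.
have r0_gt0 : 0 < r 0%N by rewrite lt0r r0_neq0 r_ge0.
have [|||f f_law] := @harmonic_simulates_unit_halving (fun n => r n / r 0%N).
- split=> n; first by rewrite divr_ge0.
  case: (r_half n) => [->|half]; first by left.
  by right; rewrite mulrA ler_pM2r ?invr_gt0.
- exact: divff.
- move=> e e_gt0; have [n r_le] := r_cvg0 _ (mulr_gt0 e_gt0 r0_gt0).
  by exists n; rewrite ler_pdivrMr.
by exists f => n; rewrite f_law -mulrBl mulrC divfK.
Qed.

End Harmonic.

(* Of the mass p x, block n takes 2^-(n+1) w_n(x) and leaves
   2^-(n+1) f_(n+1)(x), at most half of what was there if x is coded in it. *)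
Lemma simulated_blocks (R : realType) (T : countType) (p : T -> R) : is_pmf p ->
  exists (B : nat -> codebook T) (msg : T -> nat -> nat),
    (forall n, complete_codebook R (B n)) /\
    forall n x, p x * Pr (harmonic_pmf R) [set i | msg x i = n] =
      2 ^- n.+1 * weight R (B n) x.
Proof.
move=> p_pmf.
have [B [f [f0 f_pmf fS f_le B_complete]]] := dyadic_decomposition p_pmf.
pose left_mass x n := 2 ^- n * f n x.
have taken x n :
    left_mass x n - left_mass x n.+1 = 2 ^- n.+1 * weight R (B n) x.
  by rewrite /left_mass fS /residual [2 ^- n]exp2N_half; ring.
have left_halving x : halving (left_mass x).
  split=> n; first by rewrite mulr_ge0 ?exp2N_ge0//; case: (f_pmf n).
  have [xB|xB] := pselect (coded (B n) x).
    right; suff : 2 ^- n.+1 * f n x <= 2 ^- n.+1 * weight R (B n) x.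
      by rewrite -taken /left_mass [2 ^- n]exp2N_half; lra.
    by rewrite ler_wpM2l ?exp2N_ge0 ?f_le.
  by left; apply/esym/eqP; rewrite -subr_eq0 taken weight_uncoded// mulr0.
have left_cvg0 x e : 0 < e -> exists n, left_mass x n <= e.
  move=> /exp2N_le[n n_le]; exists n; apply: le_trans n_le.
  by rewrite ler_piMr ?exp2N_ge0 ?pmf_le1.
have /choice[msg msg_law] x :=
  harmonic_simulates_halving (left_halving x) (left_cvg0 x).
exists B, msg; split=> // n x; rewrite -taken -msg_law.
by rewrite /left_mass f0 invr1 mul1r.
Qed.

(** * One-way schemes *)

Lemma esum_geometric_mean_le2 (R : realType) :
  (\esum_(n in [set: nat]) (n.+1%:R * 2 ^- n.+1 : R)%:E <= 2%:E)%E.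
Proof.
rewrite -set_true; apply: (esum_nat_le (P := xpredT)) => [n|m].
  by rewrite mulr_ge0 ?exp2N_ge0.
suff -> : \sum_(n < m) n.+1%:R * 2 ^- n.+1 = 2 - m.+2%:R * 2 ^- m :> R.
  by rewrite gerBl mulr_ge0 ?exp2N_ge0.
elim: m => [|m IH]; first by rewrite big_ord0 invr1 mulr1 subrr.
rewrite big_ord_recr /= IH (exp2N_half R m).
by rewrite -[m.+3%:R]natr1 -[m.+2%:R]natr1; ring.
Qed.

Section CommonSource.
Variables (R : realType) (T U W : countType) (p : T -> R) (q : U -> R).
Hypotheses (p_pmf : is_pmf p) (q_pmf : is_pmf q).

Lemma Pr_diag xy : Pr p [set x | (x, x) = xy] = diag_pmf p xy.
Proof.
case: xy => x y; rewrite /diag_pmf /=; case: eqP => [<-|xy].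
  by rewrite -(Pr_set1 x p_pmf); congr Pr; apply/seteqP; split => [z []|_ ->].
rewrite (_ : [set z | _] = set0) ?Pr_set0//.
by apply/seteqP; split => z // [zx zy]; case: xy; rewrite -zx.
Qed.

Lemma one_way_achieves_diag (msg : T -> U -> W) (key : W -> T -> seq bool)
    (len : \bar R) (K := fun z : T * U => key (msg z.1 z.2) z.1) :
  cond_randomly_stopped (prod_pmf p q) (fun z => msg z.1 z.2) K ->
  (len <= \esum_(z in [set: T * U]) ((size (K z))%:R * prod_pmf p q z)%:E)%E ->
  one_way_achieves (diag_pmf p) 0 len.
Proof.
move=> K_stopped len_le; have P_pmf := prod_pmf_is_pmf p_pmf q_pmf.
have PrX (A : set T) (B : set U) :
    Pr (prod_pmf p q) [set z | A z.1 /\ B z.2] = Pr p A * Pr q B.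
  exact: Pr_prod_setX.
have Pr_source xy : Pr (prod_pmf p q) [set z | (z.1, z.1) = xy] = diag_pmf p xy.
  rewrite -Pr_diag -[RHS]mulr1 -(Pr_setT q_pmf) -PrX.
  by congr Pr; apply/seteqP; split => z // [].
have Pr_noise u : Pr (prod_pmf p q) [set z | z.2 = u] = Pr q [set u].
  rewrite -[RHS]mul1r -(Pr_setT p_pmf) -PrX.
  by congr Pr; apply/seteqP; split => z // [].
exists (T * U)%type, (prod_pmf p q), U, unit, W,
  (fun z => (z.1, z.1)), snd, (fun=> tt), msg,
  (fun x _ w => key w x), (fun x _ w => key w x), K => /=.
do 2!split => //; split; last split => //; last split.
- move=> xy u []; rewrite Pr_source Pr_noise.
  rewrite (_ : [set _ | tt = tt] = setT) ?Pr_setT ?mulr1//; last exact/seteqP.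
  by rewrite -Pr_diag -PrX; congr Pr; apply/seteqP; split => z /= [? []].
- rewrite subr0 -(Pr_setT P_pmf) (_ : [set z | _] = setT)//.
  by apply/seteqP; split => z //= _; rewrite !eqxx.
- by apply: le_trans len_le _; apply: le_esum => z _; rewrite !eqxx mulr1.
Qed.

End CommonSource.

Section BlockScheme.
Variables (R : realType) (T U : countType) (p : T -> R) (q : U -> R).
Hypotheses (p_pmf : is_pmf p) (q_pmf : is_pmf q).
Variables (B : nat -> codebook T) (msg : T -> U -> nat).
Hypothesis B_complete : forall n, complete_codebook R (B n).
Hypothesis block_law : forall n x,
  p x * Pr q [set u | msg x u = n] = 2 ^- n.+1 * weight R (B n) x.

Local Notation P := (prod_pmf p q).
Let block (z : T * U) := msg z.1 z.2.
Let key (z : T * U) := B (block z) z.1.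

Lemma Pr_block n : Pr P [set z | block z = n] = 2 ^- n.+1.
Proof.
apply: EFin_inj; rewrite Pr_prod_pmf//.
under eq_esum do rewrite /= block_law EFinM.
rewrite ge0_esumZl ?exp2N_ge0// => [|x]; last by rewrite lee_fin weight_ge0.
by rewrite esum_weight// mule1.
Qed.

Lemma Pr_key_block n s : Pr P [set z | key z = s /\ block z = n] =
  if s \in B n @` coded (B n) then 2 ^- n.+1 * 2 ^- size s else 0.
Proof.
apply: EFin_inj; rewrite Pr_prod_pmf//.
rewrite (eq_esum (b := fun x =>
  (if B n x == s then 2 ^- n.+1 * weight R (B n) x else 0)%:E)); last first.
  move=> x _; rewrite -block_law /key /block /=; case: eqP => [Bx|Bx].
    by congr (_ * Pr q _)%:E; apply/seteqP; split => u /= => [[]|-> ].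
  rewrite (_ : [set u | _] = set0) ?Pr_set0 ?mulr0//.
  by apply/seteqP; split => u // [] /= + un; rewrite un.
have [B_inj _] := B_complete n.
case: ifPn => [/set_mem[x xB <-]|]; last first.
  move=> sB; rewrite esum1// => x _; case: eqP => // Bx.
  rewrite weight_uncoded ?mulr0// => xB.
  by move/negP: sB; apply; apply/mem_set; exists x.
rewrite (@esum_supported1 _ _ _ x) ?eqxx ?weight_coded//.
move=> y /eqP yx; case: eqP => // By; rewrite weight_uncoded ?mulr0// => yB.
by apply: yx; apply: B_inj; rewrite ?inE.
Qed.

Lemma block_key_randomly_stopped : cond_randomly_stopped P block key.
Proof.
move=> n _; have [_ C_complete] := B_complete n.
apply: (complete_prefix_code_randomly_stopped C_complete) => s.
rewrite Pr_key_block Pr_block.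
case: ifP => _; last by rewrite mul0r.
by rewrite mulrAC divff ?mul1r// invr_eq0 expf_neq0.
Qed.

(* The mass 2^-(n+1) 2^-|k| placed on x by block n is at most p x. *)
Lemma neg_log2_le_key_length z : 0 < P z ->
  - log2 (p z.1) <= (size (key z))%:R + (block z).+1%:R.
Proof.
case: z => x u Pz; have [p_ge0 _] := p_pmf; have [q_ge0 _] := q_pmf.
have [px qu] : 0 < p x /\ 0 < q u.
  rewrite !lt0r p_ge0 q_ge0 !andbT.
  rewrite /prod_pmf /= in Pz.
  by split; apply: contraTneq Pz => ->; rewrite ?mul0r ?mulr0 ltxx.
set n := block (x, u); have Pr_gt0 : 0 < Pr q [set v | msg x v = n].
  by rewrite (lt_le_trans qu)// -(Pr_set1 u q_pmf) le_Pr// => _ ->.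
have xB : coded (B n) x.
  apply: contrapT => xB; have := mulr_gt0 px Pr_gt0.
  by rewrite block_law weight_uncoded// mulr0 ltxx.
rewrite -natrD; apply: neg_log2_le; rewrite addnC exprD invfM -weight_coded//.
by rewrite -block_law ler_piMr// -(Pr_setT q_pmf) le_Pr.
Qed.

Lemma expected_block_le2 :
  (\esum_(z in [set: T * U]) ((block z).+1%:R * P z)%:E <= 2%:E)%E.
Proof.
have P_ge0 := prod_pmf_ge0 p_pmf q_pmf.
have -> : [set: T * U] = \bigcup_(n in [set: nat]) [set z | block z = n].
  by apply/seteqP; split => z // _; exists (block z).
rewrite esum_bigcupT => [|m n _ _ [z [/= <- <-]]//|z]; last first.
  by rewrite lee_fin mulr_ge0.
apply: le_trans (esum_geometric_mean_le2 R); apply: le_esum => n _.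
rewrite -Pr_block EFinM PrE; last exact: prod_pmf_is_pmf.
rewrite -ge0_esumZl//.
by apply: le_esum => z /= <-; rewrite -EFinM.
Qed.

Lemma entropy_prod_pmf :
  (entropy p = \esum_(z in [set: T * U]) (- log2 (p z.1) * P z)%:E)%E.
Proof.
pose info x := - log2 (p x).
rewrite (esum_prod_pmf p_pmf q_pmf (f := info)) => [|x]; last first.
  by rewrite neg_log2_ge0 ?pmf_le1.
apply: eq_esum => x _.
by rewrite (_ : [set u | _] = setT)// Pr_setT// mulr1 mulNr mulrC.
Qed.

Lemma entropy_le_expected_key_length : (entropy p <=
  \esum_(z in [set: T * U]) ((size (key z))%:R * P z)%:E + 2%:E)%E.
Proof.
have P_ge0 := prod_pmf_ge0 p_pmf q_pmf.
apply: le_trans (leeD2l _ expected_block_le2).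
rewrite entropy_prod_pmf -esumD; try by move=> z _; rewrite lee_fin mulr_ge0.
apply: le_esum => z _; rewrite -EFinD lee_fin -mulrDl.
have [Pz|Pz] := ltP 0 (P z).
  by rewrite ler_wpM2r// neg_log2_le_key_length.
have -> : P z = 0 by apply/le_anti; rewrite Pz P_ge0.
by rewrite !mulr0.
Qed.

End BlockScheme.

Theorem theorem1 (R : realType) (T : countType) (pX : T -> R) :
  is_pmf pX ->
  one_way_achieves (diag_pmf pX) 0 (entropy pX - 2%:E)%E.
Proof.
move=> pX_pmf; have [B [msg [B_complete block_law]]] := simulated_blocks pX_pmf.
have harmonic := harmonic_pmf_is_pmf R.
apply: (one_way_achieves_diag (msg := msg) (key := B) pX_pmf harmonic).
  exact: block_key_randomly_stopped.
rewrite leeBlDr//.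
exact: (entropy_le_expected_key_length pX_pmf harmonic B_complete block_law).
Qed.
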